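(* Suppose that the sets of optimal solutions of $(\mathcal{P}_R)$ and of $(\mathcal{D}_R)$ are both nonempty, that the set of optimal solutions of $(\mathcal{D}_R)$ is bounded, and that the interior of the feasible set of $(\mathcal{D}_R)$ is nonempty, in the sense that there is a feasible $\bar y$ with $S(\bar y)\succ O$. Let $P\in\mathbb{S}^n$ be a nonzero negative semidefinite matrix, and let $\{\varepsilon_t\}_{t=1}^\infty$ be a monotonically decreasing sequence of positive numbers with $\lim_{t\to\infty}\varepsilon_t=0$. If the SDP relaxation of the $\varepsilon_t$-perturbed problem $(\mathcal{P}^{\varepsilon_t})$ is exact for all $t=1,2,\dots$, then the SDP relaxation of the original problem $(\mathcal{P})$ is also exact.
   Context: Let $\mathbb{S}^n$ be the space of real symmetric $n\times n$ matrices, $[m]=\{1,\dots,m\}$, and $A\bullet B=\sum_{i,j}A_{ij}B_{ij}$; $M\succeq O$ and $M\succ O$ mean positive semidefinite and positive definite. Let $Q^0,\dots,Q^m\in\mathbb{S}^n$ and $b\in\mathbb{R}^m$. Consider the QCQP $(\mathcal{P})$: minimize $x^TQ^0x$ over $x\in\mathbb{R}^n$ subject to $x^TQ^px\le b_p$ for $p\in[m]$. Throughout, $(\mathcal{P})$ is assumed to be feasible. Its SDP relaxation $(\mathcal{P}_R)$ is: minimize $Q^0\bullet X$ over $X\in\mathbb{S}^n$ subject to $Q^p\bullet X\le b_p$ for $p\in[m]$, $X\succeq O$. The dual $(\mathcal{D}_R)$ is: maximize $-b^Ty$ over $y\in\mathbb{R}^m$ subject to $y\ge 0$ and $S(y):=Q^0+\sum_{p=1}^m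 y_pQ^p\succeq O$. The SDP relaxation of a QCQP is called exact if it has an optimal solution of rank at most $1$. For $\varepsilon>0$, the $\varepsilon$-perturbed problem $(\mathcal{P}^\varepsilon)$ is the QCQP obtained from $(\mathcal{P})$ by replacing $Q^0$ with $Q^0+\varepsilon P$ and keeping all constraints; its SDP relaxation is formed in the same way. *)

(* Defs.v *)
From HB Require Import structures.
From mathcomp Require Import all_boot all_order all_algebra.
From mathcomp Require Import all_classical all_reals all_analysis.

Set Implicit Arguments.
Unset Strict Implicit.
Unset Printing Implicit Defensive.

Import Order.TTheory GRing.Theory Num.Theory.
Import numFieldNormedType.Exports.

Local Open Scope classical_set_scope.
Local Open Scope ring_scope.

Definition quadf (R : realType) (n : nat) (A : 'M[R]_n) (x : 'cV[R]_n) : R :=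
  (x^T *m A *m x) 0 0.

(* Semidefiniteness and definiteness include symmetry, so that [psd X] carries
   the constraint that X lies in the space of symmetric matrices. *)
Definition psd (R : realType) (n : nat) (A : 'M[R]_n) : Prop :=
  A \is symmetricmx /\ forall x : 'cV[R]_n, 0 <= quadf A x.

Definition nsd (R : realType) (n : nat) (A : 'M[R]_n) : Prop :=
  A \is symmetricmx /\ forall x : 'cV[R]_n, quadf A x <= 0.

Definition pd (R : realType) (n : nat) (A : 'M[R]_n) : Prop :=
  A \is symmetricmx /\ forall x : 'cV[R]_n, x != 0 -> 0 < quadf A x.

Definition mxinner (R : realType) (n : nat) (A B : 'M[R]_n) : R :=
  \sum_(i < n) \sum_(j < n) A i j * B i j.

Definition minimizers (R : realType) (T : Type) (D : set T) (f : T -> R) :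
  set T := [set x | D x /\ forall y, D y -> f x <= f y].

Definition maximizers (R : realType) (T : Type) (D : set T) (f : T -> R) :
  set T := [set x | D x /\ forall y, D y -> f y <= f x].

(* The data Q^0, (Q^p)_p and b of the problem
     minimize x^T Q^0 x  subject to  x^T Q^p x <= b_p  for all p.
   Symmetry of the matrices is the separate predicate [symmetric_data]. *)
Record qcqp (R : realType) (n m : nat) := Qcqp {
  obj : 'M[R]_n;
  con : 'I_m -> 'M[R]_n;
  rhs : 'cV[R]_m }.

Definition symmetric_data (R : realType) (n m : nat) (pb : qcqp R n m) : Prop :=
  obj pb \is symmetricmx /\ forall p : 'I_m, con pb p \is symmetricmx.

Definition qcqp_feasible (R : realType) (n m : nat) (pb : qcqp R n m) :
  set 'cV[R]_n :=
  [set x : 'cV[R]_n | forall p : 'I_m, quadf (con pb p) x <= rhs pb p 0].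

Definition sdp_feasible (R : realType) (n m : nat) (pb : qcqp R n m) :
  set 'M[R]_n :=
  [set X : 'M[R]_n | psd X /\
     forall p : 'I_m, mxinner (con pb p) X <= rhs pb p 0].

Definition sdp_optimal (R : realType) (n m : nat) (pb : qcqp R n m) :
  set 'M[R]_n := minimizers (sdp_feasible pb) (mxinner (obj pb)).

Definition slack (R : realType) (n m : nat) (pb : qcqp R n m) (y : 'cV[R]_m) :
  'M[R]_n := obj pb + \sum_(p < m) y p 0 *: con pb p.

Definition dual_feasible (R : realType) (n m : nat) (pb : qcqp R n m) :
  set 'cV[R]_m :=
  [set y : 'cV[R]_m | (forall p : 'I_m, 0 <= y p 0) /\ psd (slack pb y)].

Definition dual_optimal (R : realType) (n m : nat) (pb : qcqp R n m) :
  set 'cV[R]_m :=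
  maximizers (dual_feasible pb) (fun y : 'cV[R]_m => - ((rhs pb)^T *m y) 0 0).

Definition exact_relaxation (R : realType) (n m : nat) (pb : qcqp R n m) :
  Prop := exists X : 'M[R]_n, sdp_optimal pb X /\ (\rank X <= 1)%N.

Definition perturbed (R : realType) (n m : nat) (pb : qcqp R n m)
    (P : 'M[R]_n) (e : R) : qcqp R n m :=
  Qcqp (obj pb + e *: P) (con pb) (rhs pb).

(* Main.v *)
(* Write the rank-one optimal solutions of the perturbed relaxations as
   x_t x_t^T. Pairing x_t x_t^T with S(ybar), whose quadratic form dominates
   l |x|^2, gives (l - eps_t c) |x_t|^2 <= C, so the x_t are eventually bounded.
   For a cluster point x of (x_t), x x^T is feasible, and letting eps_t -> 0 in
   the optimality inequalities shows that it is optimal. *)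
Require Import Defs.
From HB Require Import structures.
From mathcomp Require Import all_boot all_order all_algebra.
From mathcomp Require Import all_classical all_reals all_analysis.
From mathcomp Require Import ring lra.

Import Order.TTheory GRing.Theory Num.Theory.
Import numFieldNormedType.Exports.

Local Open Scope classical_set_scope.
Local Open Scope ring_scope.

(** * Algebra of quadratic forms and of the matrix inner product *)

Lemma quadfE (R : realType) (n : nat) (A : 'M[R]_n) (x : 'cV[R]_n) :
  quadf A x = \sum_i \sum_j A i j * (x i 0 * x j 0).
Proof.
rewrite /quadf mxE [RHS]exchange_big; apply: eq_bigr => j _ /=.
rewrite mxE big_distrl; apply: eq_bigr => i _ /=.
by rewrite mxE; ring.
Qed.

Lemma quadfD (R : realType) (n : nat) (A B : 'M[R]_n) (x : 'cV[R]_n) :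
  quadf (A + B) x = quadf A x + quadf B x.
Proof. by rewrite /quadf mulmxDr mulmxDl mxE. Qed.

Lemma quadfZ (R : realType) (n : nat) (a : R) (A : 'M[R]_n) (x : 'cV[R]_n) :
  quadf (a *: A) x = a * quadf A x.
Proof. by rewrite /quadf -scalemxAr -scalemxAl mxE. Qed.

Lemma quadf_sum (R : realType) (n m : nat) (A : 'I_m -> 'M[R]_n)
    (x : 'cV[R]_n) :
  quadf (\sum_p A p) x = \sum_p quadf (A p) x.
Proof.
by rewrite /quadf mulmx_sumr mulmx_suml summxE.
Qed.

Lemma quadf_delta (R : realType) (n : nat) (A : 'M[R]_n) (i : 'I_n) :
  quadf A (delta_mx i 0) = A i i.
Proof. by rewrite /quadf trmx_delta -rowE -colE !mxE. Qed.

Lemma mxinnerD (R : realType) (n : nat) (A B X : 'M[R]_n) :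
  mxinner (A + B) X = mxinner A X + mxinner B X.
Proof.
rewrite /mxinner -big_split; apply: eq_bigr => i _ /=.
by rewrite -big_split; apply: eq_bigr => j _; rewrite mxE mulrDl.
Qed.

Lemma mxinnerZ (R : realType) (n : nat) (a : R) (A X : 'M[R]_n) :
  mxinner (a *: A) X = a * mxinner A X.
Proof.
rewrite /mxinner mulr_sumr; apply: eq_bigr => i _.
by rewrite mulr_sumr; apply: eq_bigr => j _; rewrite mxE mulrA.
Qed.

Lemma outerE (R : realType) (n : nat) (x : 'cV[R]_n) (i j : 'I_n) :
  (x *m x^T) i j = x i 0 * x j 0.
Proof. by rewrite mxE big_ord1 mxE. Qed.

Lemma mxinner_outer (R : realType) (n : nat) (A : 'M[R]_n) (x : 'cV[R]_n) :
  mxinner A (x *m x^T) = quadf A x.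
Proof.
by rewrite quadfE; apply: eq_bigr => i _; apply: eq_bigr => j _; rewrite outerE.
Qed.

(** * Rank-one positive semidefinite matrices *)

Lemma symmetricP (R : realType) (n : nat) (A : 'M[R]_n) :
  A \is symmetricmx <-> A^T = A.
Proof.
split=> [/is_hermitianmxP|AT]; first by rewrite expr0 scale1r map_mx_id.
by apply/is_hermitianmxP; rewrite expr0 scale1r map_mx_id.
Qed.

Lemma psd_outer (R : realType) (n : nat) (x : 'cV[R]_n) : psd (x *m x^T).
Proof.
split; first by apply/symmetricP; rewrite trmx_mul trmxK.
move=> z; rewrite /quadf mulmxA -mulmxA mxE big_ord1.
rewrite -[x^T *m z]trmxK trmx_mul trmxK [X in _ * X]mxE.
exact: sqr_ge0.
Qed.

Lemma rank_le1P (F : fieldType) (m n : nat) (X : 'M[F]_(m, n)) :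
  (\rank X <= 1)%N -> exists (u : 'cV[F]_m) (v : 'rV[F]_n), X = u *m v.
Proof.
move: (mulmx_base X); move: (col_base X) (row_base X).
case: (\rank X) => [|[|//]] U V defX _; last by exists U, V.
(* In rank 0 the factors have inner dimension 0, so the product vanishes and zero vectors replace
   them. *)
by exists 0, 0; rewrite -defX mul0mx thinmx0 mul0mx.
Qed.

(** The 2x2 minors of [X] vanish, so a nonzero entry [X i j] gives
    [X i i * X j j = X i j ^+ 2 != 0]. Hence the diagonal entry [X i i], nonnegative by
    semidefiniteness, is positive, and column [i] can be normalized by its square root. *)
Lemma psd_rank_le1 (R : realType) (n : nat) (X : 'M[R]_n) :
  psd X -> (\rank X <= 1)%N -> exists x : 'cV[R]_n, X = x *m x^T.
Proof.
move=> [/symmetricP symX psdX] /rank_le1P[u [v defX]].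
have XE i j : X i j = u i 0 * v 0 j by rewrite defX mxE big_ord1.
have [->|/eqP X0] := eqVneq X 0; first by exists 0; rewrite mul0mx.
have [i [j Xij]] : exists i j, X i j != 0.
  apply: contrapT => X0'; apply: X0; apply/matrixP => i j; rewrite mxE.
  by apply/eqP/negPn/negP => Xij; apply: X0'; exists i, j.
have symE k l : X k l = X l k by rewrite -[in LHS]symX mxE.
have Xii : 0 < X i i.
  rewrite lt_neqAle -quadf_delta psdX andbT quadf_delta eq_sym.
  have : X i i * X j j != 0.
    have -> : X i i * X j j = X i j * X j i by rewrite !XE; ring.
    by rewrite (symE j i) mulf_neq0.
  by rewrite mulf_eq0 negb_or => /andP[].
(* This works because [X k i * X l i = X i i * X k l], by symmetry and rank one. *)
exists ((Num.sqrt (X i i))^-1 *: col i X).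
apply/matrixP => k l; rewrite outerE !mxE.
rewrite mulrACA -expr2 exprVn sqr_sqrtr ?ltW //.
rewrite (symE l i); apply: (mulfI (lt0r_neq0 Xii)).
rewrite mulVKf ?lt0r_neq0 //; rewrite !XE; ring.
Qed.

(** * Sup-norm bounds, continuity and coercivity on row vectors *)

Lemma norm_coord_le (R : realType) (n : nat) (u : 'rV[R]_n) (i : 'I_n) :
  `|u 0 i| <= `|u|.
Proof.
rewrite [leRHS]mx_normrE.
exact: (le_bigmax _ (fun ij : 'I_1 * 'I_n => `|u ij.1 ij.2|) (0, i)).
Qed.

Lemma quadf_le_norm (R : realType) (n : nat) (A : 'M[R]_n) (u : 'rV[R]_n) :
  `|quadf A u^T| <= (\sum_i \sum_j `|A i j|) * `|u| ^+ 2.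
Proof.
rewrite quadfE mulr_suml (le_trans (ler_norm_sum _ _ _)) //.
apply: ler_sum => i _; rewrite mulr_suml (le_trans (ler_norm_sum _ _ _)) //.
apply: ler_sum => j _; rewrite !mxE !normrM ler_wpM2l // expr2.
by rewrite ler_pM // norm_coord_le.
Qed.

Lemma sum_continuous (R : realType) (T : topologicalType) (I : finType)
    (f : I -> T -> R) :
  (forall i, continuous (f i)) -> continuous (fun x => \sum_i f i x).
Proof.
move=> fc x; apply: cvg_big => [|i _]; last exact: fc.
exact: add_continuous.
Qed.

Lemma quadf_continuous (R : realType) (n : nat) (A : 'M[R]_n) :
  continuous (fun u : 'rV[R]_n => quadf A u^T).
Proof.
have -> : (fun u : 'rV[R]_n => quadf A u^T) =
    (fun u => \sum_i \sum_j A i j * (u 0 i * u 0 j)).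
  apply/funext => u; rewrite quadfE; apply: eq_bigr => i _.
  by apply: eq_bigr => j _; rewrite !mxE.
apply: sum_continuous => i; apply: sum_continuous => j u.
apply: (@continuousM _ 'rV[R]_n (fun=> A i j) (fun v => v 0 i * v 0 j)).
  exact: cst_continuous.
by apply: (@continuousM _ 'rV[R]_n (fun v => v 0 i) (fun v => v 0 j));
  exact: coord_continuous.
Qed.

Lemma closed_quadf_le (R : realType) (n : nat) (A : 'M[R]_n) (c : R) :
  closed [set u : 'rV[R]_n | quadf A u^T <= c].
Proof.
apply: (@preimage_closed _ _ _ [set x : R | x <= c]); last exact: closed_le.
by move=> u _; exact: quadf_continuous.
Qed.

Lemma closed_norm_le (R : realType) (n : nat) (c : R) :
  closed [set u : 'rV[R]_n | `|u| <= c].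
Proof.
apply: (@preimage_closed 'rV[R]_n R (fun u => `|u|) [set x : R | x <= c]).
  by move=> u _; exact: norm_continuous.
exact: closed_le.
Qed.

(** The constant is the minimum of the form over the unit sphere, attained by compactness and
    positive by definiteness; homogeneity of degree 2 extends the bound to all vectors. *)
Lemma pd_coercive (R : realType) (n : nat) (A : 'M[R]_n) : pd A ->
  exists2 l : R, 0 < l & forall u : 'rV[R]_n, l * `|u| ^+ 2 <= quadf A u^T.
Proof.
move=> [_ pdA]; pose S := [set u : 'rV[R]_n | `|u| = 1].
have normS (u : 'rV[R]_n) : u != 0 -> S (`|u|^-1 *: u).
  move=> u0; rewrite /S /= normrZ normfV normr_id mulVf ?normr_eq0 //.
have qZ (a : R) (u : 'rV[R]_n) : quadf A (a *: u)^T = a ^+ 2 * quadf A u^T.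
  rewrite !quadfE mulr_sumr; apply: eq_bigr => i _; rewrite mulr_sumr.
  by apply: eq_bigr => j _; rewrite !mxE; ring.
have q0 : quadf A (0 : 'rV_n)^T = 0 by rewrite /quadf trmx0 mulmx0 mxE.
have [S0|S0] := pselect (S !=set0); last first.
  (* With an empty sphere ([n = 0]) every vector is zero and any positive constant will do. *)
  exists 1 => // u; have [->|u0] := eqVneq u 0.
    by rewrite normr0 expr0n mulr0 q0.
  by case: S0; exists (`|u|^-1 *: u); exact: normS.
have cS : compact S.
  apply: bounded_closed_compact.
    by exists 1; split => // M M1 u /= ->; exact: ltW.
  apply: (@preimage_closed 'rV[R]_n R (fun u => `|u|) [set 1]).
    by move=> u _; exact: norm_continuous.
  exact: closed_eq.
have [|c /set_mem cS1 cmin] :=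
    compact_EVT_min S0 cS (f := fun u => quadf A u^T).
  by apply: continuous_subspaceT => u; exact: quadf_continuous.
exists (quadf A c^T).
  apply: pdA; rewrite trmx_eq0; apply/eqP => c0.
  by move: cS1; rewrite /S /= c0 normr0 => /eqP; rewrite eq_sym oner_eq0.
move=> u; have [->|u0] := eqVneq u 0.
  by rewrite normr0 expr0n mulr0 q0.
have := cmin _ (mem_set (normS u u0)).
by rewrite qZ exprVn mulrC ler_pdivlMr // exprn_gt0 // normr_gt0.
Qed.

Lemma sdp_feasible_outer (R : realType) (n m : nat) (pb : qcqp R n m)
    (x : 'cV[R]_n) :
  sdp_feasible pb (x *m x^T) <-> qcqp_feasible pb x.
Proof.
split=> [[_ xF] p|xF]; first by rewrite -mxinner_outer; exact: xF.
by split=> [|p]; [exact: psd_outer | rewrite mxinner_outer; exact: xF].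
Qed.

(** Weak duality: weight each constraint by its nonnegative multiplier and sum. *)
Lemma dual_slack_le (R : realType) (n m : nat) (pb : qcqp R n m)
    (y : 'cV[R]_m) (x : 'cV[R]_n) :
  (forall p, 0 <= y p 0) -> qcqp_feasible pb x ->
  quadf (slack pb y) x <= quadf (obj pb) x + \sum_p y p 0 * rhs pb p 0.
Proof.
move=> y0 xF; rewrite /slack quadfD quadf_sum lerD2l.
by apply: ler_sum => p _; rewrite quadfZ ler_wpM2l //; exact: xF.
Qed.

(** A bound without square roots: either [a <= 1], or [a <= a ^+ 2 <= C / l]. *)
Lemma sqr_bounded (R : realFieldType) (l a C : R) :
  0 < l -> 0 <= a -> l * a ^+ 2 <= C -> a <= 1 + C / l.
Proof.
move=> l0 a0 laC; have [a1|a1] := leP a 1.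
  rewrite (le_trans a1) // lerDl divr_ge0 ?(ltW l0) //.
  by rewrite (le_trans _ laC) // mulr_ge0 ?exprn_ge0 // ltW.
have /le_trans-> // : a <= C / l; last by rewrite lerDr.
rewrite ler_pdivlMr // mulrC (le_trans _ laC) // ler_pM2l //.
by rewrite expr2 ler_peMr // ltW.
Qed.

Theorem lemma4p3 (R : realType) (n m : nat) (pb : qcqp R n m)
    (P : 'M[R]_n) (eps : nat -> R)
    (pb_sym : symmetric_data pb)
    (pb_feasible : qcqp_feasible pb !=set0)
    (primal_attained : sdp_optimal pb !=set0)
    (dual_attained : dual_optimal pb !=set0)
    (dual_bounded : bounded_set (dual_optimal pb))
    (dual_interior :
       exists ybar : 'cV[R]_m, dual_feasible pb ybar /\ pd (slack pb ybar))
    (P_neq0 : P != 0)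
    (P_nsd : nsd P)
    (eps_gt0 : forall t : nat, 0 < eps t)
    (eps_decreasing : nonincreasing_seq eps)
    (eps_cvg0 : eps t @[t --> \oo] --> (0 : R))
    (perturbed_exact :
       forall t : nat, exact_relaxation (perturbed pb P (eps t))) :
  exact_relaxation pb.
Proof.
have [ybar [[ybar0 _] /pd_coercive[l l0 coerc]]] := dual_interior.
have [X0 [X0F _]] := primal_attained.
have /boolp.choice[u uopt] t : exists u : 'rV[R]_n,
    sdp_optimal (perturbed pb P (eps t)) (u^T *m u).
  have [X [Xopt rX]] := perturbed_exact t.
  have [x defX] := psd_rank_le1 _ _ _ Xopt.1.1 rX.
  by exists x^T; rewrite trmxK -defX.
have uF t : qcqp_feasible pb (u t)^T.
  have [+ _] := uopt t; rewrite -{2}[u t]trmxK.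
  by move/(sdp_feasible_outer _ _ _ (perturbed pb P (eps t))).
(* Perturbed optimality, rearranged to isolate the error of order [eps t]. *)
have uobj t Y : sdp_feasible pb Y -> quadf (obj pb) (u t)^T <=
    mxinner (obj pb) Y + eps t * (mxinner P Y - quadf P (u t)^T).
  move=> /((uopt t).2 Y); rewrite -{2}[u t]trmxK mxinner_outer /=.
  by rewrite mxinnerD mxinnerZ quadfD quadfZ; lra.
pose cP := \sum_i \sum_j `|P i j|.
have cP0 : 0 <= cP by apply: sumr_ge0 => i _; apply: sumr_ge0.
have quadP t : - quadf P (u t)^T <= cP * `|u t| ^+ 2.
  by rewrite lerNl; have := quadf_le_norm _ _ P (u t);
    rewrite ler_norml => /andP[].
pose b := \sum_p ybar p 0 * rhs pb p 0.
(* [C] collects the terms independent of [u t] once [eps t <= 1]; half of the coercivity constant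
   [l] is spent on absorbing the perturbation. *)
pose C := `|mxinner (obj pb) X0| + `|mxinner P X0| + `|b|.
pose M := 1 + C / (l / 2).
have eps_small (d : R) : 0 < d -> \forall t \near \oo, eps t <= d.
  move=> d0; have /cvgrPdist_le/(_ d d0) := eps_cvg0.
  apply: filterS => t; rewrite sub0r normrN => /(le_trans _); apply.
  exact: ler_norm.
have uM : \forall t \near \oo, `|u t| <= M.
  (* The second bound yields [eps t * cP <= l / 2]; the added 1 keeps the denominator positive when
     [cP = 0]. *)
  have d0 : 0 < Num.min 1 (l / 2 / (1 + cP)).
    by rewrite lt_min ltr01 !divr_gt0 // ltr_wpDr.
  apply: filterS (eps_small _ d0) => t; rewrite le_min => /andP[e1 e2].
  apply: sqr_bounded; rewrite ?divr_gt0 //.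
  have epsP : - (eps t * quadf P (u t)^T) <= l / 2 * `|u t| ^+ 2.
    have ecP : eps t * cP <= l / 2.
      move: e2; rewrite ler_pdivlMr ?ltr_wpDr // mulrDr mulr1.
      by apply: le_trans; rewrite lerDr ltW.
    rewrite (le_trans _ (ler_wpM2r (sqr_ge0 _) ecP)) // -mulrA -mulrN.
    by rewrite ler_wpM2l ?quadP ?ltW.
  have epsX0 : eps t * mxinner P X0 <= `|mxinner P X0|.
    rewrite (le_trans (ler_norm _)) // normrM (gtr0_norm (eps_gt0 t)).
    by rewrite ler_piMl.
  (* Chain coercivity, weak duality and optimality against [X0], then move [l / 2 * |u t| ^+ 2] to
     the left. *)
  have := coerc (u t); have := dual_slack_le _ _ _ _ _ _ ybar0 (uF t).
  have := uobj t X0 X0F; have := ler_norm b.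
  have := ler_norm (mxinner (obj pb) X0).
  by rewrite /C -/b; lra.
have uK : compact [set v : 'rV[R]_n | `|v| <= M].
  apply: bounded_closed_compact; last exact: closed_norm_le.
  exists M; split=> [|N MN v /= /le_trans]; first exact: num_real.
  by apply; exact: ltW.
have [v [vM vcl]] := uK (u @ \oo) _ uM.
(* A closed sublevel set containing a tail of the sequence contains its cluster points, so no
   subsequence is extracted. *)
have clim A c : (\forall t \near \oo, quadf A (u t)^T <= c) ->
    quadf A v^T <= c.
  move=> uc; move: vcl; rewrite clusterE.
  move=> /(_ [set w : 'rV[R]_n | quadf A w^T <= c] uc).
  by rewrite -(closure_id _).1 //; exact: closed_quadf_le.
exists (v^T *m v); split; last first.
  by rewrite (leq_trans (mulmx_max_rank _ _)).
rewrite -{2}[v]trmxK; split=> [|Y YF].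
  apply/sdp_feasible_outer => p; apply: clim.
  by apply: nearW => t; exact: uF.
(* It suffices that [u t] is eventually within [e] of beating [Y]. Here [D] bounds the bracket in
   [uobj] on the ball of radius [M], and [eps t * (1 + D) <= e] eventually. *)
rewrite mxinner_outer; apply/ler_addgt0Pr => e e0; apply: clim.
pose D := `|mxinner P Y| + cP * M ^+ 2.
have D0 : 0 <= D by rewrite addr_ge0 // mulr_ge0 // sqr_ge0.
have d0 : 0 < e / (1 + D) by rewrite divr_gt0 // ltr_wpDr.
near=> t.
have ed : eps t <= e / (1 + D) by near: t; exact: eps_small.
have utM : `|u t| <= M by near: t.
rewrite (le_trans (uobj t Y YF)) // lerD2l.
have DP : mxinner P Y - quadf P (u t)^T <= D.
  apply: lerD; first exact: ler_norm.
  apply: le_trans (quadP t) _.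
  by rewrite ler_wpM2l // lerXn2r ?nnegrE ?(le_trans (normr_ge0 _) utM).
rewrite (le_trans (ler_wpM2l (ltW (eps_gt0 t)) DP)) //.
move: ed; rewrite ler_pdivlMr ?ltr_wpDr //.
by rewrite mulrDr mulr1; apply: le_trans; rewrite lerDr ltW.
Unshelve. all: by end_near.
Qed.
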